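(* Let $a>0$ be fixed and, for $n>0$, let $L(n)$ be the arc length of the supercircle with scale parameter $a$ and shape parameter $n$. Then $$\lim_{n\to\infty}L(n)=8a,\qquad \lim_{n\to0^+}L(n)=8a,\qquad L(1)=4\sqrt2\,a.$$
   Context: For real $a>0$, $n>0$, the supercircle with scale parameter $a$ and shape parameter $n$ is the closed plane curve given in polar coordinates by $r(\theta)=a\left(|\cos\theta|^n+|\sin\theta|^n\right)^{-1/n}$, $\theta\in[0,2\pi]$. Its arc length is the total length of this closed curve. *)

(* Defs.v *)
From mathcomp Require Import all_boot all_order all_algebra.
From mathcomp Require Import all_classical all_reals all_analysis.

Set Implicit Arguments.
Unset Strict Implicit.
Unset Printing Implicit Defensive.
Import Order.TTheory GRing.Theory Num.Theory.
Import numFieldNormedType.Exports.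

Local Open Scope classical_set_scope.
Local Open Scope ring_scope.

(* The library norm on the product [R * R] is the max norm, so the Euclidean
   distance is spelled out. *)
Definition euclidean_dist (R : realType) (p q : R * R) : R :=
  Num.sqrt ((p.1 - q.1) ^+ 2 + (p.2 - q.2) ^+ 2).

(* Two-dimensional analogue of the library's [variation], with the same
   convention on partitions: [s] lists the points after [a], ending with [b]. *)
Definition polygon_length (R : realType) (a b : R) (gamma : R -> R * R)
    (s : seq R) : R :=
  let F := gamma \o nth b (a :: s) in
  \sum_(0 <= i < size s) euclidean_dist (F i.+1) (F i).

(* Supremum of the lengths of inscribed polygonal lines; it is [+oo] for a
   non-rectifiable curve. *)
Definition arc_length (R : realType) (a b : R) (gamma : R -> R * R) : \bar R :=
  ereal_sup [set (polygon_length a b gamma s)%:E | s in itv_partition a b].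

Definition polar_curve (R : realType) (r : R -> R) (theta : R) : R * R :=
  (r theta * cos theta, r theta * sin theta).

(* [powR 0 n = 0] for [n > 0], so the points where [cos] or [sin] vanishes are
   handled correctly. *)
Definition supercircle_radius (R : realType) (a n theta : R) : R :=
  a * (`|cos theta| `^ n + `|sin theta| `^ n) `^ (- n^-1).

Definition supercircle_length (R : realType) (a n : R) : \bar R :=
  arc_length 0 (2 * pi) (polar_curve (supercircle_radius a n)).

(* Main.v *)
(* In each quadrant both coordinates are monotone, so the length is at most the
   sum of the total variations of the two coordinates, [8 * a] for every shape
   [n > 0]. Conversely, the inscribed octagon with vertices at the multiples of
   [pi / 4] has eight sides of length [a * sqrt ((1 - q) ^ 2 + q ^ 2)], where
   [q = 2 `^ (- 1 / n)] tends to [1] as [n] tends to infinity and to [0] as [n]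
   tends to [0]; in both cases its perimeter tends to [8 * a]. For [n = 1] the
   octagon has perimeter [4 * sqrt 2 * a], and the matching upper bound comes
   from the total variations of [x - y] and [x + y]: in these coordinates
   rotated by [pi / 4] every side of the curve is parallel to an axis. *)

Require Import Defs.
From mathcomp Require Import all_boot all_order all_algebra.
From mathcomp Require Import all_classical all_reals all_analysis.
From mathcomp Require Import ring lra.

Set Implicit Arguments.
Unset Strict Implicit.
Unset Printing Implicit Defensive.
Import Order.TTheory GRing.Theory Num.Theory.
Import numFieldNormedType.Exports.

Local Open Scope classical_set_scope.
Local Open Scope ring_scope.

(** * Total variation under translations and quarter turns *)

Lemma nonincreasing_total_variation (R : realType) (a b : R) (f : R -> R) :
  a <= b -> {in `[a, b] &, nonincreasing_fun f} ->
  total_variation a b f = (f a - f b)%:E.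
Proof.
move=> ab nif; rewrite -total_variationN nondecreasing_total_variation//.
  by rewrite opprK addrC.
by move=> x y xab yab xy; rewrite lerN2 nif.
Qed.

Lemma total_variation_shift (R : realType) (a b c : R) (f : R -> R) :
  (total_variation (a + c) (b + c) f <=
   total_variation a b (fun t => f (t + c)%R))%E.
Proof.
apply: ge_ereal_sup => _ [_ [s [ps /eqP ls] <-] <-].
apply: ereal_sup_ubound; exists (variation (a + c) (b + c) f s) => //.
exists (map (fun x => x - c) s).
  split; last first.
    by rewrite -[a in last a _](addrK c) (last_map (fun x => x - c)) ls addrK.
  rewrite -[a in path _ a _](addrK c) (@path_map _ _ (fun x => x - c)).
  by apply: sub_path ps => x y /=; rewrite ltrD2r.
rewrite /variation size_map; apply: eq_big_nat => i /andP[_ ilt] /=.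
(* The list [a :: s] has [size s + 1] entries, so [j = size s] is still in range and neither default
   is read. *)
have E j : (j <= size s)%N ->
    nth b (a :: [seq x - c | x <- s]) j + c = nth (b + c) (a + c :: s) j.
  case: j => [//|j] js /=.
  by rewrite (nth_map (b + c))// subrK.
by congr (`| f _ - f _ |); [exact: (E i.+1)|apply: E; exact: ltnW].
Qed.

(** A shift by [h] swaps [f] and [g] up to sign, so each interval of length [h] contributes the same
    amount to the sum of both variations; on the first one, monotonicity gives it. *)
Lemma total_variation_quarter_turn (R : realType) (h : R) (f g : R -> R) :
  0 <= h -> (forall t, f (t + h) = - g t) -> (forall t, g (t + h) = f t) ->
  {in `[0, h] &, nonincreasing_fun f} -> {in `[0, h] &, nondecreasing_fun g} ->
  (total_variation 0 (4 * h) f + total_variation 0 (4 * h) g <=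
   (4 * (f 0 - f h + (g h - g 0)))%:E)%E.
Proof.
move=> h0 fh gh nif ndg.
have TVfh b : (total_variation h (b + h) f <= total_variation 0 b g)%E.
  have := total_variation_shift 0 b h f; rewrite add0r => /le_trans; apply.
  by under eq_fun do rewrite fh; rewrite total_variationN.
have TVgh b : (total_variation h (b + h) g <= total_variation 0 b f)%E.
  have := total_variation_shift 0 b h g; rewrite add0r => /le_trans; apply.
  by under eq_fun do rewrite gh.
have TVDh u b : 0 <= b -> total_variation 0 (b + h) u =
    (total_variation 0 h u + total_variation h (b + h) u)%E.
  by move=> b0; apply: total_variationD => //; rewrite lerDr.
(* [[0, h]] is split off and the rest is shifted back onto [[0, b]], where the two functions have
   traded places. *)
have step b : 0 <= b ->
    (total_variation 0 (b + h) f + total_variation 0 (b + h) g <=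
     (f 0 - f h + (g h - g 0))%:E +
     (total_variation 0 b f + total_variation 0 b g))%E.
  move=> b0; rewrite !TVDh// addeACA.
  rewrite nonincreasing_total_variation// nondecreasing_total_variation//.
  by rewrite -EFinD leeD2l// addeC leeD.
have {}step k : (total_variation 0 (k%:R * h) f + total_variation 0 (k%:R * h) g
    <= (k%:R * (f 0 - f h + (g h - g 0)))%:E)%E.
  elim: k => [|k IH]; first by rewrite !mul0r !total_variationxx adde0.
  rewrite -natr1 2!mulrDl !mul1r; apply: le_trans (step _ _) _.
    by rewrite mulr_ge0.
  by rewrite [in leRHS]addrC [in leRHS]EFinD leeD2l.
exact: step.
Qed.

(** * General bounds on arc length *)

(** Summing the hypothesis over the sides of an inscribed polygon compares it with the variations of
    [f] and [g] on the same partition. Here [f] and [g] will be coordinates of [gamma] along two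
    perpendicular axes, up to scale. *)
Lemma arc_length_le (R : realType) (a b c : R) (gamma : R -> R * R)
    (f g : R -> R) : a <= b -> 0 <= c ->
  (forall s t, euclidean_dist (gamma s) (gamma t) <=
               c * (`|f s - f t| + `|g s - g t|)) ->
  (arc_length a b gamma <=
   c%:E * (total_variation a b f + total_variation a b g))%E.
Proof.
move=> ab c0 dist_le; apply: ge_ereal_sup => _ [s abs <-].
have /le_trans -> // : ((polygon_length a b gamma s)%:E <=
    (c * (variation a b f s + variation a b g s))%:E)%E.
  rewrite lee_fin /polygon_length /variation -big_split mulr_sumr/=.
  by apply: ler_sum => i _; exact: dist_le.
rewrite EFinM lee_wpmul2l ?lee_fin// EFinD.
apply: leeD; apply: ereal_sup_ubound.
  by exists (variation a b f s) => //; exact: variations_variation.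
by exists (variation a b g s) => //; exact: variations_variation.
Qed.

Lemma arc_length_ge (R : realType) (a b : R) (gamma : R -> R * R) (s : seq R) :
  itv_partition a b s -> ((polygon_length a b gamma s)%:E <=
  arc_length a b gamma)%E.
Proof. by move=> abs; apply: ereal_sup_ubound; exists s. Qed.

(** * Coordinates of the unit supercircle *)

(* First coordinate of the point of the unit supercircle on the ray through
   [(x, y)]. *)
Definition unit_coord (R : realType) (n x y : R) : R :=
  x * (`|x| `^ n + `|y| `^ n) `^ (- n^-1).

Definition circ_x (R : realType) (n t : R) := unit_coord n (cos t) (sin t).
Definition circ_y (R : realType) (n t : R) := unit_coord n (sin t) (cos t).

Lemma supercircleE (R : realType) (a n t : R) :
  polar_curve (supercircle_radius a n) t = (a * circ_x n t, a * circ_y n t).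
Proof.
rewrite /polar_curve /supercircle_radius /circ_x /circ_y /unit_coord.
by rewrite [in X in _ = (_, X)]addrC; congr pair; ring.
Qed.

(** With [circ_yDpihalf], this is the invariance of the curve under a quarter turn. *)
Lemma circ_xDpihalf (R : realType) (n t : R) :
  circ_x n (t + pi / 2) = - circ_y n t.
Proof.
by rewrite /circ_x /circ_y /unit_coord cosDpihalf sinDpihalf normrN mulNr.
Qed.

Lemma circ_yDpihalf (R : realType) (n t : R) :
  circ_y n (t + pi / 2) = circ_x n t.
Proof.
by rewrite /circ_x /circ_y /unit_coord cosDpihalf sinDpihalf normrN.
Qed.

Lemma unit_coordE (R : realType) (n x y : R) : 0 < n -> 0 < x -> 0 <= y ->
  unit_coord n x y = (1 + (y / x) `^ n) `^ (- n^-1).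
Proof.
move=> n0 x0 y0; have xn0 := powR_gt0 n x0.
rewrite /unit_coord !ger0_norm ?(ltW x0)//.
have -> : x `^ n + y `^ n = x `^ n * (1 + (y / x) `^ n).
  rewrite mulrDr mulr1 -powRM ?(ltW x0)// ?divr_ge0 ?(ltW x0)//.
  by rewrite mulrC divfK ?gt_eqF.
rewrite powRM ?addr_ge0 ?powR_ge0// -powRrM mulrN divff ?gt_eqF//.
by rewrite powR_inv1 ?(ltW x0)// mulrA divff ?gt_eqF// mul1r.
Qed.

Lemma unit_coord_ge0 (R : realType) (n x y : R) : 0 <= x -> 0 <= unit_coord n x y.
Proof. by move=> x0; rewrite mulr_ge0// powR_ge0. Qed.

Lemma unit_coord_le (R : realType) (n x y x' y' : R) : 0 < n ->
  0 <= x <= x' -> 0 <= y' <= y -> unit_coord n x y <= unit_coord n x' y'.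
Proof.
move=> n0 /andP[x0 xx'] /andP[y'0 y'y]; have y0 := le_trans y'0 y'y.
(* For [x = 0] there is no slope, but the left-hand side vanishes. *)
have := x0; rewrite le_eqVlt => /predU1P[x_eq|{}x0].
  by rewrite {1}/unit_coord -x_eq mul0r unit_coord_ge0// (le_trans x0 xx').
have x'0 := lt_le_trans x0 xx'.
have pos z : 0 < 1 + z `^ n by rewrite ltr_pwDl// powR_ge0.
rewrite (unit_coordE n0 x0 y0) (unit_coordE n0 x'0 y'0) 2!powRN.
rewrite lef_pV2 ?posrE; [|exact: powR_gt0..].
apply: ge0_ler_powR; rewrite ?invr_ge0 ?nnegrE ?(ltW (pos _)) ?(ltW n0)//.
rewrite lerD2l; apply: ge0_ler_powR;
  rewrite ?nnegrE ?divr_ge0 ?(ltW n0) ?(ltW x0) ?(ltW x'0)//.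
by rewrite ler_pM ?invr_ge0 ?(ltW x'0)// lef_pV2 ?posrE.
Qed.

Lemma circ_x0 (R : realType) (n : R) : 0 < n -> circ_x n 0 = 1.
Proof.
move=> n0; rewrite /circ_x cos0 sin0 unit_coordE//.
by rewrite mul0r powR0 ?gt_eqF// addr0 powR1.
Qed.

Lemma circ_y0 (R : realType) (n : R) : circ_y n 0 = 0.
Proof. by rewrite /circ_y /unit_coord sin0 mul0r. Qed.

Lemma circ_xpihalf (R : realType) (n : R) : circ_x n (pi / 2) = 0.
Proof. by rewrite -[pi / 2]add0r circ_xDpihalf circ_y0 oppr0. Qed.

Lemma circ_ypihalf (R : realType) (n : R) : 0 < n -> circ_y n (pi / 2) = 1.
Proof. by move=> n0; rewrite -[pi / 2]add0r circ_yDpihalf circ_x0. Qed.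

Lemma cos_pi4_gt0 (R : realType) : 0 < cos (pi / 4) :> R.
Proof.
by have := pi_gt0 R => pi0; apply: cos_gt0_pihalf; apply/andP; split; lra.
Qed.

Lemma sin_pi4 (R : realType) : sin (pi / 4) = cos (pi / 4) :> R.
Proof.
have := tan_piquarter R; rewrite /tan => /(canRL (divfK _)) ->.
  by rewrite mul1r.
by rewrite gt_eqF// cos_pi4_gt0.
Qed.

(** On the diagonal the slope is 1. *)
Lemma circ_xpi4 (R : realType) (n : R) : 0 < n ->
  circ_x n (pi / 4) = 2 `^ (- n^-1).
Proof.
move=> n0; have c0 := cos_pi4_gt0 R.
by rewrite /circ_x sin_pi4 unit_coordE ?(ltW c0)// divff ?gt_eqF// powR1.
Qed.

Lemma circ_ypi4 (R : realType) (n : R) : 0 < n ->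
  circ_y n (pi / 4) = 2 `^ (- n^-1).
Proof. by move=> n0; rewrite -(circ_xpi4 n0) /circ_y /circ_x sin_pi4. Qed.

(** * Behaviour in the first quadrant *)

Lemma cos_sin_monotone_quadrant1 (R : realType) (s t : R) :
  s \in `[0, pi / 2] -> t \in `[0, pi / 2] -> s <= t ->
  0 <= cos t <= cos s /\ 0 <= sin s <= sin t.
Proof.
have pi0 := pi_gt0 R.
rewrite !in_itv/= => /andP[s0 s1] /andP[t0 t1] st; split; apply/andP; split.
- by apply: cos_ge0_pihalf; lra.
- by rewrite leNgt ltr_cos ?in_itv/= -?leNgt//; lra.
- by apply: sin_ge0_pi; lra.
- by rewrite leNgt ltr_sin ?in_itv/= -?leNgt//; lra.
Qed.

Lemma circ_x_nonincreasing (R : realType) (n : R) : 0 < n ->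
  {in `[0, pi / 2] &, nonincreasing_fun (circ_x n)}.
Proof.
move=> n0 s t sI tI st; have [? ?] := cos_sin_monotone_quadrant1 sI tI st.
exact: unit_coord_le.
Qed.

Lemma circ_y_nondecreasing (R : realType) (n : R) : 0 < n ->
  {in `[0, pi / 2] &, nondecreasing_fun (circ_y n)}.
Proof.
move=> n0 s t sI tI st; have [? ?] := cos_sin_monotone_quadrant1 sI tI st.
exact: unit_coord_le.
Qed.

(** For shape 1 the radius is the inverse of [cos t + sin t] in this quadrant. *)
Lemma circ_xDy1 (R : realType) (t : R) : t \in `[0, pi / 2] ->
  circ_x 1 t + circ_y 1 t = 1.
Proof.
move=> tI; have [/andP[c0 _] /andP[s0 _]] := cos_sin_monotone_quadrant1 tI tI (lexx t).
rewrite /circ_x /circ_y /unit_coord !powRr1// !ger0_norm//.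
rewrite [sin t + cos t]addrC -mulrDl invr1 powR_inv1 ?addr_ge0// divff//.
(* Two nonnegative numbers with sum zero both vanish, against [cos2Dsin2]. *)
apply/eqP => cs0; have := cos2Dsin2 t.
have -> : sin t = - cos t by lra.
have -> : cos t = 0 by lra.
by rewrite oppr0 expr0n addr0 => /esym/eqP; rewrite oner_eq0.
Qed.

(** * Upper bounds on the length *)

Lemma euclidean_dist_le_norm1 (R : realType) (p q : R * R) :
  euclidean_dist p q <= `|p.1 - q.1| + `|p.2 - q.2|.
Proof.
rewrite /euclidean_dist; move: (p.1 - q.1) (p.2 - q.2) => u v.
rewrite -[leRHS]ger0_norm ?addr_ge0// -sqrtr_sqr ler_wsqrtr//.
rewrite -(real_normK (num_real u)) -(real_normK (num_real v)).
by have := mulr_ge0 (normr_ge0 u) (normr_ge0 v); lra.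
Qed.

(** The map from [(x, y)] to [(x - y, x + y)] is a rotation by [pi / 4] scaled by [Num.sqrt 2], so
    the previous bound applies to the images. *)
Lemma euclidean_dist_le_rotated (R : realType) (p q : R * R) :
  euclidean_dist p q <= (Num.sqrt 2)^-1 *
    (`|(p.1 - p.2) - (q.1 - q.2)| + `|(p.1 + p.2) - (q.1 + q.2)|).
Proof.
have s2 : 0 < Num.sqrt (2 : R) by rewrite sqrtr_gt0.
rewrite mulrC ler_pdivlMr// mulrC -sqrtrM//.
have -> : 2 * ((p.1 - q.1) ^+ 2 + (p.2 - q.2) ^+ 2) =
  (p.1 - p.2 - (q.1 - q.2)) ^+ 2 + (p.1 + p.2 - (q.1 + q.2)) ^+ 2 by ring.
pose u : R * R := (p.1 - p.2, p.1 + p.2).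
pose v : R * R := (q.1 - q.2, q.1 + q.2).
exact: (euclidean_dist_le_norm1 u v).
Qed.

Lemma supercircle_length_le (R : realType) (a n : R) : 0 < a -> 0 < n ->
  (supercircle_length a n <= (8 * a)%:E)%E.
Proof.
move=> a0 n0; have pi0 := pi_gt0 R.
pose f t := a * circ_x n t; pose g t := a * circ_y n t.
have pi2 : 2 * pi = 4 * (pi / 2) :> R by field.
rewrite /supercircle_length pi2.
apply: le_trans (@arc_length_le _ _ _ 1 _ f g _ _ _) _ => //.
- by lra.
- move=> s t; rewrite !supercircleE mul1r; exact: euclidean_dist_le_norm1.
rewrite mul1e.
apply: le_trans (@total_variation_quarter_turn _ (pi / 2) f g _ _ _ _ _) _.
- by lra.
- by move=> t; rewrite /f circ_xDpihalf mulrN.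
- by move=> t; rewrite /g circ_yDpihalf.
- move=> s t sI tI st; rewrite /f (ler_pM2l a0); exact: (circ_x_nonincreasing n0 sI tI st).
- move=> s t sI tI st; rewrite /g (ler_pM2l a0); exact: (circ_y_nondecreasing n0 sI tI st).
rewrite /f /g circ_x0// circ_y0 circ_xpihalf circ_ypihalf// lee_fin; lra.
Qed.

Lemma supercircle_length1_le (R : realType) (a : R) : 0 < a ->
  (supercircle_length a 1 <= (4 * Num.sqrt 2 * a)%:E)%E.
Proof.
move=> a0; have pi0 := pi_gt0 R.
(* In the first quadrant [f] falls from [a] to [- a] while [g] stays equal to [a]; four quadrants
   give [8 * a], to be divided by [Num.sqrt 2]. *)
pose f t := a * (circ_x 1 t - circ_y 1 t).
pose g t := a * (circ_x 1 t + circ_y 1 t).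
have s2 : 0 < Num.sqrt (2 : R) by rewrite sqrtr_gt0.
have pi2 : 2 * pi = 4 * (pi / 2) :> R by field.
rewrite /supercircle_length pi2.
apply: le_trans (@arc_length_le _ _ _ (Num.sqrt 2)^-1 _ f g _ _ _) _.
- by lra.
- by rewrite invr_ge0 ltW.
- move=> s t; rewrite 2!supercircleE /f /g.
  move: (circ_x 1 s) (circ_y 1 s) (circ_x 1 t) (circ_y 1 t) => x y x' y'.
  by rewrite !(mulrBr a) !(mulrDr a); exact: euclidean_dist_le_rotated.
have -> : (4 * Num.sqrt 2 * a)%:E =
    ((Num.sqrt 2)^-1%:E * (8 * a)%:E :> \bar R)%E.
  rewrite -EFinM; congr EFin.
  have : Num.sqrt 2 * Num.sqrt 2 = 2 :> R by rewrite -expr2 sqr_sqrtr.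
  by move=> e; field: e; rewrite gt_eqF.
rewrite lee_wpmul2l ?lee_fin ?invr_ge0 ?(ltW s2)//.
have gE t : t \in `[0, pi / 2] -> g t = a.
  by move=> tI; rewrite /g circ_xDy1// mulr1.
apply: le_trans (@total_variation_quarter_turn _ (pi / 2) f g _ _ _ _ _) _.
- by lra.
- by move=> t; rewrite /f /g circ_xDpihalf circ_yDpihalf; ring.
- by move=> t; rewrite /f /g circ_xDpihalf circ_yDpihalf; ring.
- move=> s t sI tI st; rewrite /f (ler_pM2l a0); apply: lerB.
    exact: (circ_x_nonincreasing ltr01 sI tI st).
  exact: (circ_y_nondecreasing ltr01 sI tI st).
- by move=> s t sI tI st; rewrite !gE.
rewrite !gE ?in_itv/= ?lexx ?andbT; [|lra..].
by rewrite /f circ_x0// circ_y0 circ_xpihalf circ_ypihalf// lee_fin; lra.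
Qed.

(** * Lower bound from the inscribed octagon *)

Lemma euclidean_dist_supercircleDpihalf (R : realType) (a n s t : R) :
  let gamma := polar_curve (supercircle_radius a n) in
  euclidean_dist (gamma (s + pi / 2)) (gamma (t + pi / 2)) =
  euclidean_dist (gamma s) (gamma t).
Proof.
rewrite /= 4!supercircleE 2!circ_xDpihalf 2!circ_yDpihalf.
move: (circ_x n s) (circ_y n s) (circ_x n t) (circ_y n t) => x y x' y'.
rewrite /euclidean_dist/=.
by congr Num.sqrt; ring.
Qed.

Lemma supercircle_length_ge (R : realType) (a n : R) : 0 < n ->
  ((8 * (`|a| * Num.sqrt ((1 - 2 `^ (- n^-1)) ^+ 2 + (2 `^ (- n^-1)) ^+ 2)))%:E
   <= supercircle_length a n)%E.
Proof.
move=> n0; have pi0 := pi_gt0 R; set q := 2 `^ (- n^-1).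
pose gamma := polar_curve (supercircle_radius a n).
have dist_q k : euclidean_dist (gamma (k.+1%:R * (pi / 4)))
    (gamma (k%:R * (pi / 4))) = `|a| * Num.sqrt ((1 - q) ^+ 2 + q ^+ 2).
  (* The two sides in the first quadrant are computed; side [k + 2] is side [k] after a quarter
     turn. *)
  elim/ltn_ind: k => -[_|[_|k IH]].
  - rewrite mul1r mul0r /gamma !supercircleE /euclidean_dist/=.
    rewrite circ_x0// circ_y0 circ_xpi4// circ_ypi4// -/q -sqrtr_sqr.
    by rewrite -sqrtrM ?sqr_ge0//; congr Num.sqrt; ring.
  - have -> : 2 * (pi / 4) = pi / 2 :> R by field.
    rewrite mul1r /gamma !supercircleE /euclidean_dist/=.
    rewrite circ_xpihalf circ_ypihalf// circ_xpi4// circ_ypi4// -/q -sqrtr_sqr.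
    by rewrite -sqrtrM ?sqr_ge0//; congr Num.sqrt; ring.
  - have E m : m.+2%:R * (pi / 4) = m%:R * (pi / 4) + pi / 2 :> R.
      by rewrite -addn2 natrD; field.
    by rewrite !E euclidean_dist_supercircleDpihalf IH.
(* A partition omits its left endpoint, so the list starts at [pi / 4] and ends at [2 * pi]. *)
pose s : seq R := [seq k.+1%:R * (pi / 4) | k <- iota 0 8].
have sP : itv_partition 0 (2 * pi) s.
  split; last by apply/eqP => /=; field.
  rewrite /s /=; do !(apply/andP; split=> //); lra.
apply: le_trans (arc_length_ge _ sP); rewrite lee_fin /polygon_length.
rewrite (eq_big_nat _ _ (F2 := fun=> `|a| * Num.sqrt ((1 - q) ^+ 2 + q ^+ 2))).
  by rewrite big_const_nat iter_addr addr0 mulr_natl.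
move=> k /andP[_ k8]; rewrite -(dist_q k); congr euclidean_dist.
  by move: k k8; do 8 case=> //.
by move: k k8; case=> [|k] k8; [rewrite /= mul0r|move: k k8; do 7 case=> //].
Qed.

(** * Limits in the shape parameter *)

Lemma powRV2_cvgy (R : realType) :
  (2 : R) `^ (- n^-1) @[n --> +oo] --> (1 : R).
Proof.
have -> : (fun n : R => (2 : R) `^ (- n^-1)) = (fun n => expR (- n^-1 * ln 2)).
  by apply/funext => n; rewrite /powR gt_eqF.
have invy : (n : R)^-1 @[n --> +oo] --> (0 : R).
  apply/gtr0_cvgV0; last exact: cvg_id.
  exact: nbhs_pinfty_gt.
have expy : - n^-1 * ln 2 @[n --> +oo] --> - 0 * ln (2 : R).
  by apply: cvgMr_tmp; exact: cvgN.
rewrite oppr0 mul0r in expy; rewrite -[X in _ --> X]expR0.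
exact: (cvg_comp _ _ expy (@continuous_expR R 0)).
Qed.

Lemma powRV2_cvg0 (R : realType) :
  (2 : R) `^ (- n^-1) @[n --> 0^'+] --> (0 : R).
Proof.
have ln2 : 0 < ln (2 : R) by rewrite ln_gt0// ltr1n.
have -> : (fun n : R => (2 : R) `^ (- n^-1)) = (fun n => expR (- (n / ln 2)^-1)).
  by apply/funext => n; rewrite /powR gt_eqF// invf_div mulNr mulrC.
have divV : ((n : R) / ln 2)^-1 @[n --> 0^'+] --> +oo.
  apply/cvgrVy.
    by near=> n; rewrite divr_gt0.
  rewrite -[X in _ --> X](mul0r (ln 2)^-1); apply: cvgMr_tmp.
  exact/cvg_at_right_filter/cvg_id.
exact: cvg_comp _ _ divV (@cvgr_expR R).
Unshelve. all: by end_near. Qed.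

(** A squeeze between the octagon's perimeter and [8 * a], stated for a filter to serve both limits.
    The equation on [l] says that [l] is 0 or 1. *)
Lemma supercircle_length_cvg (R : realType) (a l : R) (F : set_system R)
    {FF : Filter F} : 0 < a -> (\forall n \near F, 0 < n) ->
  2 `^ (- n^-1) @[n --> F] --> l -> (1 - l) ^+ 2 + l ^+ 2 = 1 ->
  supercircle_length a n @[n --> F] --> (8 * a)%:E.
Proof.
move=> a0 F0 Fl l1.
pose lo (n : R) : R := 8 *
  (`|a| * Num.sqrt ((1 - 2 `^ (- n^-1)) ^+ 2 + (2 `^ (- n^-1)) ^+ 2)).
apply: (@squeeze_cvge _ _ _ _ (EFin \o lo) _ (fun=> (8 * a)%:E)).
- apply: filterS F0 => n n0; rewrite supercircle_length_le// andbT.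
  exact: supercircle_length_ge.
- have -> : 8 * a = 8 * (`|a| * Num.sqrt ((1 - l) ^+ 2 + l ^+ 2)).
    by rewrite l1 sqrtr1 mulr1 gtr0_norm.
  apply: cvg_EFin; first exact: nearW.
  apply: cvgMl_tmp; apply: cvgMl_tmp.
  apply: continuous_cvg; first exact: sqrt_continuous.
  by apply: cvgD; rewrite !expr2; apply: cvgM => //; apply: cvgB => //;
    exact: cvg_cst.
- exact: cvg_cst.
Qed.

Theorem proposition3p4 (R : realType) (a : R) (ha : 0 < a) :
  [/\ supercircle_length a n @[n --> +oo] --> (8 * a)%:E,
      supercircle_length a n @[n --> 0^'+] --> (8 * a)%:E
    & supercircle_length a 1 = (4 * Num.sqrt 2 * a)%:E].
Proof.
split.
- apply: (supercircle_length_cvg (l := 1)) => //; [exact: nbhs_pinfty_gt|exact: powRV2_cvgy|].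
  by rewrite subrr expr0n add0r expr1n.
- apply: (supercircle_length_cvg (l := 0)) => //; [exact: nbhs_right_gt|exact: powRV2_cvg0|].
  by rewrite subr0 expr0n addr0 expr1n.
apply/eqP; rewrite eq_le supercircle_length1_le//=.
apply: le_trans (@supercircle_length_ge _ a 1 ltr01); rewrite lee_fin.
rewrite invr1 powR_inv1// gtr0_norm//.
(* For shape 1 the octagon has vertices at the corners and side midpoints of the square, so its
   perimeter is already the upper bound. *)
have -> : (1 - 2^-1) ^+ 2 + 2^-1 ^+ 2 = 2 * (2^-1) ^+ 2 :> R by field.
by rewrite sqrtrM// sqrtr_sqr ger0_norm ?invr_ge0//; lra.
Qed.
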